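(* Let $0<d_1<\cdots<d_k<n$ be integers and let $\mathbf{M}=(M_1,\dots,M_k)\in\mathcal{M}^{d_1,\dots,d_k}_n$ be a plurimatroid. Then the thin Schubert cell $$\mathbb{F}_{\mathbf{M}}=\left(\prod_{i=1}^kG_{M_i}\right)\cap\mathbb{F}_{d_1<\cdots<d_k}(\mathbb{C}^n)$$ is affine and a locally closed set in $\mathbb{F}_{d_1<\cdots<d_k}(\mathbb{C}^n)$.
   Context: $[n]=\{1,\dots,n\}$ and $\binom{[n]}{d}$ is the set of $d$-element subsets of $[n]$. A matroid of rank $d$ on $n$ elements is a pair $M=([n],\mathcal{B})$ with $\emptyset\neq\mathcal{B}\subset\binom{[n]}{d}$ such that for all $I,J\in\mathcal{B}$ and $i\in I\setminus J$ there is $j\in J\setminus I$ with $(I\setminus\{i\})\cup\{j\}\in\mathcal{B}$; the elements of $\mathcal{B}$ are its bases. $\mathcal{M}^d_n$ is the set of such matroids, and $\mathcal{M}^{d_1,\dots,d_k}_n=\mathcal{M}^{d_1}_n\times\cdots\times\mathcal{M}^{d_k}_n$; its elements are called plurimatroids. $G(d,n)$ is the Grassmannian of $d$-dimensional subspaces of $\mathbb{C}^n$ with Plücker coordinates $(p_I)_{I\in\binom{[n]}{d}}$. For $M=([n],\mathcal{B})\in\mathcal{M}^d_n$, $G_M=\{W\in G(d,n): p_I(W)\neq0\Leftrightarrow I\in\mathcal{B}\}$. The flag variety is $\mathbb{F}_{d_1<\cdots<d_k}(\mathbb{C}^n)=\{W_1\subset\cdots\subset W_k\subset\mathbb{C}^n:\dim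 W_i=d_i\}\subset\prod_{i=1}^kG(d_i,n)$, with the Zariski topology. *)

(* Defs.v *)
(* The ground set [n] is 'I_n = {0, ..., n-1}; the complex numbers are R[i] for
   R : realType. *)
From mathcomp Require Import all_boot all_order all_algebra.
From mathcomp Require Import complex mpoly.
From mathcomp Require Import boolp classical_sets reals.

Set Implicit Arguments.
Unset Strict Implicit.
Unset Printing Implicit Defensive.

Import GRing.Theory.
Local Open Scope ring_scope.
Local Open Scope classical_set_scope.

Record matroid (n d : nat) := Matroid {
  bases : {set {set 'I_n}};
  bases_neq0 : bases != finset.set0;
  bases_card : forall I, I \in bases -> #|I| = d;
  bases_exchange : forall (I J : {set 'I_n}) (i : 'I_n),
    I \in bases -> J \in bases -> i \in I :\: J ->
    exists2 j : 'I_n, j \in J :\: I & (j |: (I :\ i))%SET \in bases }.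

Definition plurimatroid (n k : nat) (d : 'I_k -> nat) : Type :=
  forall i : 'I_k, matroid n (d i).

Definition dsubset (n d : nat) := {I : {set 'I_n} | #|I| == d}.

(* The d x d minor of A on the columns in I, taken in increasing order. *)
Definition minor (K : fieldType) (n d : nat) (A : 'M[K]_(d, n))
    (I : dsubset n d) : K :=
  \det (colsub (fun j : 'I_d =>
          enum_val (cast_ord (esym (eqP (valP I))) j)) A).

(* Homogeneous Pluecker coordinates of a d-dimensional W, for the basis
   [vbasis W].  Another basis rescales all of them by one nonzero constant;
   below they only enter through homogeneous equations and through quotients of
   forms of equal degree. *)
Definition plucker (K : fieldType) (n d : nat) (W : {vspace 'rV[K]_n})
    (I : dsubset n d) : K :=
  minor (\matrix_(i < d) (vbasis W)`_i) I.

Definition grassmannian (K : fieldType) (n d : nat) : set {vspace 'rV[K]_n} :=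
  [set W | \dim W = d].

Definition grass_cell (K : fieldType) (n d : nat) (M : matroid n d) :
    set {vspace 'rV[K]_n} :=
  [set W | grassmannian d W /\
     forall I : dsubset n d, plucker W I <> 0 <-> val I \in bases M].

Definition flag_variety (K : fieldType) (n k : nat) (d : 'I_k -> nat) :
    set ('I_k -> {vspace 'rV[K]_n}) :=
  [set W | (forall i, grassmannian (d i) (W i)) /\
     forall i j : 'I_k, (i <= j)%N -> (W i <= W j)%VS].
Arguments flag_variety K {n k} d W.

Definition flag_cell (K : fieldType) (n k : nat) (d : 'I_k -> nat)
    (M : plurimatroid n d) : set ('I_k -> {vspace 'rV[K]_n}) :=
  [set W | forall i, grass_cell (M i) (W i)] `&` flag_variety K d.
Arguments flag_cell K {n k d} M W.

(* Classical varieties, as subsets of an ambient set T.  The family A e gives,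
   for each degree e, the functions on T induced by the forms of degree e: all
   polynomials (with a single degree) for affine space, multihomogeneous
   polynomials evaluated at chosen homogeneous coordinates for a product of
   projective spaces.  In the latter case neither the vanishing of a form nor
   the quotient of two forms of equal degree depends on the choice. *)

Definition zero_locus (K : fieldType) (T : Type) (S : set (T -> K)) : set T :=
  [set x | forall p, S p -> p x = 0].

Definition zariski_closed (K : fieldType) (D T : Type)
    (A : D -> set (T -> K)) (X Z : set T) : Prop :=
  exists2 S : set (T -> K), (forall p, S p -> exists e, A e p) &
    Z = X `&` zero_locus S.

Definition zariski_open (K : fieldType) (D T : Type)
    (A : D -> set (T -> K)) (X U : set T) : Prop :=
  U `<=` X /\ zariski_closed A X (X `\` U).

Definition locally_closed (K : fieldType) (D T : Type)
    (A : D -> set (T -> K)) (X Y : set T) : Prop :=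
  exists U Z : set T,
    [/\ zariski_open A X U, zariski_closed A X Z & Y = U `&` Z].

Definition regular_on (K : fieldType) (D T : Type)
    (A : D -> set (T -> K)) (U : set T) (f : T -> K) : Prop :=
  forall x, U x -> exists N : set T, [/\ zariski_open A U N, N x &
    exists e p q, [/\ A e p, A e q &
      forall y, N y -> q y <> 0 /\ f y = p y / q y]].

Definition morphism_on (K : fieldType) (D T D' T' : Type)
    (A : D -> set (T -> K)) (A' : D' -> set (T' -> K))
    (X : set T) (Y : set T') (phi : T -> T') : Prop :=
  [/\ forall x, X x -> Y (phi x),
      forall V, zariski_open A' Y V -> zariski_open A X (X `&` phi @^-1` V) &
      forall V h, zariski_open A' Y V -> regular_on A' V h ->
        regular_on A (X `&` phi @^-1` V) (h \o phi)].

Definition isomorphic_on (K : fieldType) (D T D' T' : Type)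
    (A : D -> set (T -> K)) (A' : D' -> set (T' -> K))
    (X : set T) (Y : set T') : Prop :=
  exists (phi : T -> T') (psi : T' -> T),
    [/\ morphism_on A A' X Y phi, morphism_on A' A Y X psi,
        forall x, X x -> psi (phi x) = x & forall y, Y y -> phi (psi y) = y].

Definition affine_forms (K : fieldType) (N : nat) (_ : unit) :
    set ('rV[K]_N -> K) :=
  [set p | exists P : {mpoly K[N]}, p = fun x : 'rV[K]_N => P.@[fun i => x 0 i]].

(* A possibly reducible, possibly empty affine variety. *)
Definition is_affine (K : fieldType) (D T : Type)
    (A : D -> set (T -> K)) (X : set T) : Prop :=
  exists (N : nat) (Y : set 'rV[K]_N),
    zariski_closed (@affine_forms K N) setT Y /\
    isomorphic_on A (@affine_forms K N) X Y.

(* One variable for each i and each d_i-subset I, standing for the I-th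
   Pluecker coordinate of the i-th subspace. *)
Definition plucker_index (n k : nat) (d : 'I_k -> nat) : finType :=
  {i : 'I_k & dsubset n (d i)}.

Definition multihomogeneous (K : fieldType) (n k : nat) (d : 'I_k -> nat)
    (e : 'I_k -> nat) (P : {mpoly K[#|plucker_index n d|]}) : Prop :=
  forall m, m \in msupp P -> forall i : 'I_k,
    (\sum_(x : plucker_index n d | tag x == i) m (enum_rank x))%N = e i.

(* The Zariski topology and regular functions on the product of Grassmannians
   come from its Pluecker embedding in a product of projective spaces. *)
Definition plucker_forms (K : fieldType) (n k : nat) (d : 'I_k -> nat)
    (e : 'I_k -> nat) : set (('I_k -> {vspace 'rV[K]_n}) -> K) :=
  [set p | exists2 P : {mpoly K[#|plucker_index n d|]},
     multihomogeneous e P &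
     p = fun W => P.@[fun j => let x : plucker_index n d := enum_val j in
                               plucker (W (tag x)) (tagged x)]].
Arguments plucker_forms K n {k} d e p.

(* Main.v *)
(* Fix a basis I_i of each M_i.  On the cell, W_i is the row space of a unique
   matrix A_i whose columns in I_i form the identity; its entries are, up to
   sign, 0 or ratios p_J / p_(I_i), and its minors are the ratios
   p_I / p_(I_i).  In these coordinates W_i <= W_j is the polynomial equation
   A_i = (A_i restricted to I_j) A_j, and membership in the cells says that
   minors at non-bases vanish while minors at bases are invertible.  Adding
   the inverses of the latter as coordinates makes the cell a closed subset of
   an affine space.  The cell is locally closed because it is cut out of the
   flag variety by the nonvanishing of the product of the basis coordinates and
   the vanishing of the others. *)
Require Import Defs.
From mathcomp Require Import all_boot all_order all_algebra.
From mathcomp Require Import perm.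
From mathcomp Require Import complex mpoly.
From mathcomp Require Import boolp classical_sets reals.

Set Implicit Arguments.
Unset Strict Implicit.
Unset Printing Implicit Defensive.

Import GRing.Theory.
Local Open Scope ring_scope.
Local Open Scope classical_set_scope.

(** * Pullback of forms along a map, and the morphisms it yields *)

Section Pullback.
Variables (K : fieldType) (D T D' T' : Type).
Variables (A : D -> set (T -> K)) (A' : D' -> set (T' -> K)).
Variable phi : T -> T'.

(* The factor [u] absorbs common denominators and changes of homogeneous
   coordinates; as it is the same for [p] and [q], zero loci and
   quotients of forms of equal degree pull back along [phi]. *)
Definition pulls_back_forms (X : set T) : Prop :=
  forall e p q, A' e p -> A' e q -> exists e' p' q' (u : T -> K),
    [/\ A e' p', A e' q' & forall x, X x ->
      [/\ u x != 0, p (phi x) = u x * p' x & q (phi x) = u x * q' x]].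

Lemma pulls_back_formsW (X X0 : set T) :
  X0 `<=` X -> pulls_back_forms X -> pulls_back_forms X0.
Proof.
move=> sX0 pX e p q Ap Aq; have [e' [p' [q' [u [A1 A2 H]]]]] := pX e p q Ap Aq.
by exists e', p', q', u; split=> // x /sX0 /H.
Qed.

(** The equations of [Y \ V] pull back to equations of the complement of the preimage: as [u] has no
    zero on [X], [p \o phi] and [p'] vanish at the same points of [X]. *)
Lemma zariski_open_preimage (X : set T) (Y V : set T') :
    pulls_back_forms X -> (forall x, X x -> Y (phi x)) ->
  zariski_open A' Y V -> zariski_open A X (X `&` phi @^-1` V).
Proof.
move=> pX XY [VY [S AS YV]]; split; first by move=> x [].
(* Taking every form that represents the pullback of some member of [S] avoids choosing one
   representative per equation. *)
exists [set p' | (exists e', A e' p') /\ exists p (u : T -> K), S p /\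
    forall x, X x -> u x != 0 /\ p (phi x) = u x * p' x].
  by move=> p [].
apply/seteqP; split=> x [Xx].
  move=> nV; split=> // p' [_ [p [u [Sp /(_ x Xx) [u0 pE]]]]].
  have : (Y `\` V) (phi x) by split; [exact: XY | move=> Vx; apply: nV].
  rewrite YV => -[_ /(_ p Sp)]; rewrite pE => /eqP.
  by rewrite mulf_eq0 (negPf u0) => /eqP.
move=> zx; split=> // -[_ /= Vx].
have : (Y `&` zero_locus S) (phi x).
  split; first exact: XY.
  move=> p Sp; have [e Ap] := AS p Sp.
  have [e' [p' [q' [u [A1 A2 H]]]]] := pX e p p Ap Ap.
  have [_ -> _] := H x Xx; suff -> : p' x = 0 by rewrite mulr0.
  apply: zx; split; first by exists e'.
  by exists p, u; split=> // z /H [].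
by rewrite -YV => -[].
Qed.

(** Preimages of open sets are open, and the common factor [u] cancels in a quotient of two forms of
    equal degree, so local fractions pull back to local fractions. *)
Lemma pulls_back_forms_morphism (X : set T) (Y : set T') :
    (forall x, X x -> Y (phi x)) -> pulls_back_forms X ->
  morphism_on A A' X Y phi.
Proof.
move=> XY pX; split=> //; first by move=> V; exact: zariski_open_preimage.
move=> V h [VY _] hreg x [Xx /= Vx].
have [N [oN Nx [e [p [q [Ap Aq hE]]]]]] := hreg _ Vx.
exists ((X `&` phi @^-1` V) `&` phi @^-1` N); split=> //.
  (* Openness is now relative to the preimage of [V], so the pullback property is restricted to that
     set. *)
  apply: zariski_open_preimage oN => [|y [] //].
  by apply: pulls_back_formsW pX => y [].
have [e' [p' [q' [u [A1 A2 H]]]]] := pX e p q Ap Aq.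
exists e', p', q'; split=> // y [[Xy _] /= /hE [q0 hy]].
have [u0 pE qE] := H y Xy; split.
  by move=> q'0; apply: q0; rewrite qE q'0 mulr0.
by rewrite hy pE qE invfM mulrACA divff // mul1r.
Qed.

End Pullback.

(** * Functions given by a single fraction on a whole set *)

Section GlobalFractions.
Variables (K : fieldType) (D T : Type) (A : D -> set (T -> K)).
Variables (d0 : D) (dadd : D -> D -> D).
Hypothesis formsC : forall c, A d0 (fun=> c).
Hypothesis formsD : forall e p q, A e p -> A e q -> A e (p \+ q).
Hypothesis formsM :
  forall e e' p q, A e p -> A e' q -> A (dadd e e') (p \* q).

(** Unlike in [regular_on], one numerator and one denominator serve on all of [X], so sums and
    products are plain arithmetic of fractions, with no neighbourhoods to intersect. *)
Definition global_fraction (X : set T) (f : T -> K) : Prop :=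
  exists e p q, [/\ A e p, A e q & forall x, X x -> q x != 0 /\ f x = p x / q x].

Variable X : set T.

Lemma global_fraction_eq f g : (forall x, X x -> g x = f x) ->
  global_fraction X f -> global_fraction X g.
Proof.
move=> gf [e [p [q [Ap Aq fE]]]]; exists e, p, q; split=> // x Xx.
by rewrite gf //; exact: fE.
Qed.

Lemma global_fractionC c : global_fraction X (fun=> c).
Proof.
by exists d0, (fun=> c), (fun=> 1); split=> // x _; rewrite oner_eq0 divr1.
Qed.

Lemma global_fractionD f g :
  global_fraction X f -> global_fraction X g -> global_fraction X (f \+ g).
Proof.
move=> [e [p [q [Ap Aq fE]]]] [e' [p' [q' [Ap' Aq' gE]]]].
(* Both summands must have degree [dadd e e']; the order in [q \* p'] matters because [dadd] is not
   assumed commutative. *)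
exists (dadd e e'), ((p \* q') \+ (q \* p')), (q \* q').
split; [by apply: formsD; exact: formsM | exact: formsM |].
move=> x Xx /=; have [q0 ->] := fE x Xx; have [q'0 ->] := gE x Xx.
by rewrite mulf_neq0 // addf_div // [p' x * _]mulrC.
Qed.

Lemma global_fractionM f g :
  global_fraction X f -> global_fraction X g -> global_fraction X (f \* g).
Proof.
move=> [e [p [q [Ap Aq fE]]]] [e' [p' [q' [Ap' Aq' gE]]]].
exists (dadd e e'), (p \* p'), (q \* q'); split; try exact: formsM.
move=> x Xx /=; have [q0 ->] := fE x Xx; have [q'0 ->] := gE x Xx.
by rewrite mulf_neq0 // mulf_div.
Qed.

(** Constants and products give the monomials in the [F x j]; induction on the terms of [P] then
    gives all polynomials. *)
Lemma global_fraction_meval (N : nat) (F : T -> 'I_N -> K) (P : {mpoly K[N]}) :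
    (forall j, global_fraction X (fun x => F x j)) ->
  global_fraction X (fun x => P.@[F x]).
Proof.
move=> FX; have fX m : global_fraction X (fun x => 'X_[m].@[F x]).
  rewrite (_ : (fun _ => _) = fun x => \prod_i F x i ^+ m i); last first.
    by apply/funext=> x; rewrite mevalX.
  elim: (index_enum _) => [|i r IH].
    by under eq_fun do rewrite big_nil; exact: global_fractionC.
  under eq_fun do rewrite big_cons.
  apply: (@global_fractionM (fun x => F x i ^+ m i)) => //.
  elim: (m i) => [|k IHk].
    by under eq_fun do rewrite expr0; exact: global_fractionC.
  by under eq_fun do rewrite exprS; exact: global_fractionM.
elim/mpolyind: P => [|c m P _ _ IH].
  by under eq_fun do rewrite meval0; exact: global_fractionC.
under eq_fun do rewrite mevalD mevalZ.
apply: global_fractionD IH.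
by apply: (@global_fractionM (fun=> c)) => //; exact: global_fractionC.
Qed.

Lemma pulls_back_affine_forms (N : nat) (phi : T -> 'rV[K]_N) :
    (forall j, global_fraction X (fun x => phi x 0 j)) ->
  pulls_back_forms A (@affine_forms K N) phi X.
Proof.
move=> phiX [] _ _ [P ->] [Q ->].
have [e [p [q [Ap Aq PE]]]] := global_fraction_meval P phiX.
have [e' [p' [q' [Ap' Aq' QE]]]] := global_fraction_meval Q phiX.
(* Over the common denominator [q \* q'] both numerators have the same degree; the inverse of that
   denominator is the factor [u]. *)
exists (dadd e e'), (p \* q'), (q \* p'), (fun x => (q x * q' x)^-1).
split; try exact: formsM.
move=> x Xx /=; have [q0 ->] := PE x Xx; have [q'0 ->] := QE x Xx.
split; first by rewrite invr_eq0 mulf_neq0.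
  by rewrite [RHS]mulrC -mulf_div divff // mulr1.
by rewrite [RHS]mulrC -mulf_div divff // mul1r.
Qed.

End GlobalFractions.

(** * Multihomogeneous polynomials and Plücker forms *)

Section PluckerForms.
Variables (K : fieldType) (n k : nat) (d : 'I_k -> nat).
Implicit Types (e : 'I_k -> nat) (P Q : {mpoly K[#|plucker_index n d|]}).

Lemma multihomogeneousC c : multihomogeneous (fun=> 0%N)
  (c%:MP : {mpoly K[#|plucker_index n d|]}).
Proof.
move=> m; rewrite msuppC; case: eqP => // _; rewrite inE => /eqP -> i.
by rewrite big1 // => x _; rewrite mnm0E.
Qed.

Lemma multihomogeneousX (x : plucker_index n d) :
  multihomogeneous (fun i => (tag x == i) : nat)
    ('X_(enum_rank x) : {mpoly K[#|plucker_index n d|]}).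
Proof.
move=> m; rewrite msuppX inE => /eqP -> i; rewrite big_mkcond /= (bigD1 x) //=.
rewrite mnm1E eqxx big1 ?addn0; first by case: (_ == _).
move=> y yx; rewrite mnm1E (inj_eq enum_rank_inj) [x == y]eq_sym (negPf yx).
exact: if_same.
Qed.

Lemma multihomogeneousD e P Q :
  multihomogeneous e P -> multihomogeneous e Q -> multihomogeneous e (P + Q).
Proof.
by move=> hP hQ m /msuppD_le; rewrite mem_cat => /orP[/hP|/hQ].
Qed.

Lemma multihomogeneousM e e' P Q : multihomogeneous e P ->
  multihomogeneous e' Q -> multihomogeneous (fun i => e i + e' i)%N (P * Q).
Proof.
move=> hP hQ m /msuppM_le /allpairsP[[m1 m2] /= [/hP h1 /hQ h2 ->]] i.
by rewrite -h1 -h2 -big_split /=; apply: eq_bigr => x _; rewrite mnmDE.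
Qed.

(** Each monomial of [P] has degree [e i] in the variables of block [i], so rescaling the blocks
    multiplies all monomials by the same product. This accounts for a change of homogeneous
    coordinates. *)
Lemma meval_multihomogeneous e P (c : 'I_k -> K) (v : plucker_index n d -> K) :
    multihomogeneous e P ->
  P.@[fun j => c (tag (enum_val j)) * v (enum_val j)] =
  (\prod_i c i ^+ e i) * P.@[fun j => v (enum_val j)].
Proof.
move=> hP; rewrite !mevalE big_distrr /=; apply: eq_big_seq => m /hP mE.
rewrite mulrCA; congr (_ * _).
under eq_bigr do rewrite exprMn.
rewrite big_split /=; congr (_ * _).
rewrite (reindex (@enum_rank _)) /=; last by apply: onW_bij; exact: enum_rank_bij.
under eq_bigr do rewrite enum_rankK.
(* Grouping the variables by block collects the scalars into powers of [c i], with the block degrees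
   as exponents. *)
rewrite (partition_big (fun x : plucker_index n d => tag x) predT) //=.
apply: eq_bigr => i _; rewrite -mE expr_sum.
by apply: eq_bigr => x /eqP <-.
Qed.

Lemma plucker_formsC c : plucker_forms K n d (fun=> 0%N) (fun=> c).
Proof.
exists c%:MP; first exact: multihomogeneousC.
by apply/funext=> W; rewrite mevalC.
Qed.

Lemma plucker_formsD e p q : plucker_forms K n d e p ->
  plucker_forms K n d e q -> plucker_forms K n d e (p \+ q).
Proof.
move=> [P hP ->] [Q hQ ->]; exists (P + Q); first exact: multihomogeneousD.
by apply/funext=> W; rewrite mevalD.
Qed.

Lemma plucker_formsM e e' p q : plucker_forms K n d e p ->
  plucker_forms K n d e' q ->
  plucker_forms K n d (fun i => e i + e' i)%N (p \* q).
Proof.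
move=> [P hP ->] [Q hQ ->]; exists (P * Q); first exact: multihomogeneousM.
by apply/funext=> W; rewrite mevalM.
Qed.

Lemma plucker_forms_coord i (I : dsubset n (d i)) :
  plucker_forms K n d (fun j => (i == j) : nat) (fun W => plucker (W i) I).
Proof.
exists 'X_(enum_rank (Tagged (fun i => dsubset n (d i)) I)).
  exact: multihomogeneousX.
by apply/funext=> W; rewrite mevalXU enum_rankK.
Qed.

Lemma plucker_forms_prod (J : Type) (r : seq J)
    (F : J -> ('I_k -> {vspace 'rV[K]_n}) -> K) :
    (forall j, exists e, plucker_forms K n d e (F j)) ->
  exists e, plucker_forms K n d e (fun W => \prod_(j <- r) F j W).
Proof.
move=> hF; elim: r => [|j r [e he]].
  exists (fun=> 0%N); rewrite [X in plucker_forms _ _ _ _ X](_ : _ = fun=> 1).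
    exact: plucker_formsC.
  by apply/funext=> W; rewrite big_nil.
have [e' he'] := hF j; exists (fun i => e' i + e i)%N.
rewrite [X in plucker_forms _ _ _ _ X](_ : _ =
  F j \* (fun W => \prod_(j <- r) F j W)); first exact: plucker_formsM.
by apply/funext=> W; rewrite big_cons.
Qed.

End PluckerForms.

(** * Affine charts of the Grassmannian *)

Section Charts.
Variables (K : fieldType) (n d : nat).
Implicit Types (I J : dsubset n d) (W : {vspace 'rV[K]_n}).

Definition dsubset_enum I (j : 'I_d) : 'I_n :=
  enum_val (cast_ord (esym (eqP (valP I))) j).

Lemma dsubset_enum_inj I : injective (dsubset_enum I).
Proof. by move=> a b /enum_val_inj /cast_ord_inj. Qed.

Lemma dsubset_enum_onto I x : x \in val I -> exists j, dsubset_enum I j = x.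
Proof.
move=> xI; exists (cast_ord (eqP (valP I)) (enum_rank_in xI x)).
by rewrite /dsubset_enum cast_ordK enum_rankK_in.
Qed.

(** A repeated column makes the determinant vanish; otherwise [g] enumerates its image up to a
    permutation, whose sign is [c]. It matters later that [c] and [J] do not depend on [A]. *)
Lemma det_colsub_minor (g : 'I_d -> 'I_n) I : exists (c : K) J,
  forall A : 'M[K]_(d, n), \det (colsub g A) = c * minor A J.
Proof.
have [/injectiveP ginj|/injectivePn[a [b ab gab]]] := boolP (injectiveb g);
  last first.
  (* With [c = 0] any [J] will do, and [I] supplies one. *)
  exists 0, I => A; rewrite mul0r -det_tr.
  by apply: (determinant_alternate ab) => j; rewrite !mxE gab.
have cJ : #|[set g j | j : 'I_d]%SET| == d by rewrite card_imset // card_ord.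
pose J : dsubset n d := exist (fun I : {set 'I_n} => #|I| == d) _ cJ.
have /choice[s sE] : forall j, exists i, dsubset_enum J i = g j.
  by move=> j; apply: dsubset_enum_onto; apply/imsetP; exists j.
have sinj : injective s.
  by move=> a b /(congr1 (dsubset_enum J)); rewrite !sE => /ginj.
exists (\det (perm_mx (perm sinj)^-1%g)), J => A.
rewrite mulrC -det_mulmx -col_permE; congr (\det _).
by apply/matrixP=> a b; rewrite !mxE permE -sE.
Qed.

Definition rowspan m (A : 'M[K]_(m, n)) : {vspace 'rV[K]_n} :=
  limg (linfun (mulmxr A)).

Lemma rowspanP m (A : 'M[K]_(m, n)) v :
  reflect (exists u, v = u *m A) (v \in rowspan A).
Proof.
by apply: (iffP memv_imgP) => [[u _ ->]|[u ->]]; exists u; rewrite ?memvf ?lfunE.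
Qed.

Lemma rowspan_subP m p (A : 'M[K]_(m, n)) (B : 'M[K]_(p, n)) :
  reflect (exists C, A = C *m B) (rowspan A <= rowspan B)%VS.
Proof.
apply: (iffP subvP) => [sAB|[C ->] v /rowspanP[u ->]]; last first.
  by apply/rowspanP; exists (u *m C); rewrite mulmxA.
have /choice[C CE] : forall i, exists u, row i A = u *m B.
  by move=> i; apply/rowspanP/sAB/rowspanP; exists (delta_mx 0 i); rewrite rowE.
exists (\matrix_i C i); apply/row_matrixP => i.
by rewrite CE row_mul rowK.
Qed.

Definition basis_mx W : 'M[K]_(d, n) := \matrix_(i < d) (vbasis W)`_i.

Lemma rowspan_basis_mx W : \dim W = d -> rowspan (basis_mx W) = W.
Proof.
move=> dW; apply/vspaceP => v; apply/rowspanP/idP => [[u ->]|vW].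
  rewrite mulmx_sum_row rpred_sum // => i _; apply: rpredZ.
  by rewrite rowK; apply/vbasis_mem/mem_nth; rewrite size_tuple dW.
exists (\row_i coord (vbasis W) (cast_ord (esym dW) i) v).
rewrite {1}(coord_vbasis vW) mulmx_sum_row (reindex (cast_ord (esym dW))) /=.
  by apply: eq_bigr => i _; rewrite mxE rowK.
by apply: onW_bij; exists (cast_ord dW) => i; rewrite ?cast_ordK ?cast_ordKV.
Qed.

(** The normalised matrix of [W] in the chart at [I], meaningful only when [plucker W I != 0]:
    [invmx] returns a singular matrix unchanged. *)
Definition chart_mx I W : 'M[K]_(d, n) :=
  invmx (colsub (dsubset_enum I) (basis_mx W)) *m basis_mx W.

Lemma plucker_unitmx I W : plucker W I != 0 ->
  colsub (dsubset_enum I) (basis_mx W) \in unitmx.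
Proof. by move=> pI; rewrite unitmxE unitfE. Qed.

Lemma chart_mx_col I W : plucker W I != 0 ->
  colsub (dsubset_enum I) (chart_mx I W) = 1%:M.
Proof. by move=> /plucker_unitmx U; rewrite -mulmx_colsub mulVmx. Qed.

Lemma mul_chart_mx I W : plucker W I != 0 ->
  colsub (dsubset_enum I) (basis_mx W) *m chart_mx I W = basis_mx W.
Proof. by move=> /plucker_unitmx U; rewrite mulKVmx. Qed.

Lemma rowspan_chart_mx I W :
  \dim W = d -> plucker W I != 0 -> rowspan (chart_mx I W) = W.
Proof.
move=> dW pI; rewrite -{2}(rowspan_basis_mx dW); apply: subv_anti.
apply/andP; split; apply/rowspan_subP; first by eexists.
by exists (colsub (dsubset_enum I) (basis_mx W)); rewrite mul_chart_mx.
Qed.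

(** The basis matrix is its block on [I] times the chart matrix, and that block has determinant
    [plucker W I]. *)
Lemma det_colsub_basis_mx (g : 'I_d -> 'I_n) I W : plucker W I != 0 ->
  \det (colsub g (basis_mx W)) = plucker W I * \det (colsub g (chart_mx I W)).
Proof.
by move=> pI; rewrite -[in LHS](mul_chart_mx pI) -mulmx_colsub det_mulmx.
Qed.

Lemma plucker_chart_mx I J W : plucker W I != 0 ->
  plucker W J = plucker W I * minor (chart_mx I W) J.
Proof. exact: det_colsub_basis_mx. Qed.

(* Replacing one column of the identity by column [b] of the chart matrix gives
   a determinant equal to an entry of that matrix. *)
Lemma chart_mx_entry I (a : 'I_d) (b : 'I_n) : exists (c : K) J,
  forall W, plucker W I != 0 -> chart_mx I W a b = c * plucker W J / plucker W I.
Proof.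
pose g j := if j == a then b else dsubset_enum I j.
have [c [J cE]] := det_colsub_minor g I; exists c, J => W pI.
rewrite -[_ * plucker W J]cE (det_colsub_basis_mx _ pI) mulrC mulKf //.
have N1 i j : j != a -> colsub g (chart_mx I W) i j = (i == j)%:R.
  move=> ja; have /matrixP/(_ i j) := chart_mx_col pI.
  by rewrite !mxE /g (negPf ja).
(* Outside column [a] the matrix agrees with the identity, so only the diagonal term survives in the
   expansion along row [a]. *)
rewrite (expand_det_row _ a) (bigD1 a) //= big1 ?addr0 => [|j ja]; last first.
  by rewrite N1 // eq_sym (negPf ja) mul0r.
rewrite /cofactor -signr_odd addnn odd_double expr0 mul1r.
rewrite (_ : row' a _ = 1%:M) ?det1 ?mulr1; first by rewrite [RHS]mxE /g eqxx.
apply/matrixP => i j; rewrite mxE [LHS]mxE N1 ?(inj_eq lift_inj) ?mxE //.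
by rewrite eq_sym neq_lift.
Qed.

(** Uniqueness of the normalised matrix: if [A = C *m B] with [B] the basis matrix, comparing the
    columns in [I] shows that [C] inverts the block of [B] on [I]. *)
Lemma chart_mx_rowspan I (A : 'M[K]_(d, n)) :
    colsub (dsubset_enum I) A = 1%:M ->
  [/\ \dim (rowspan A) = d, plucker (rowspan A) I != 0 &
      chart_mx I (rowspan A) = A].
Proof.
move=> A1; have dA : \dim (rowspan A) = d.
  rewrite limg_dim_eq ?dimvf ?/dim /= ?mul1n //.
  (* The map [u |-> u *m A] is injective, since the columns of [u *m A] in [I] give back [u]. *)
  apply/eqP; rewrite capfv; apply/lker0P => u v; rewrite !lfunE /= => uv.
  by rewrite -[u]mulmx1 -[v]mulmx1 -A1 !mulmx_colsub uv.
have [C AE] : exists C, A = C *m basis_mx (rowspan A).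
  by apply/rowspan_subP; rewrite rowspan_basis_mx.
have CB : C *m colsub (dsubset_enum I) (basis_mx (rowspan A)) = 1%:M.
  by rewrite mulmx_colsub -AE.
have [_ U] := mulmx1_unit CB; split=> //.
  by move: U; rewrite unitmxE unitfE.
by rewrite [RHS]AE /chart_mx; congr (_ *m _); rewrite -[LHS]mul1mx -CB mulmxK.
Qed.

End Charts.

(** * The closed model of the cell in affine space *)

Section AffineModel.
Variables (K : fieldType) (n k : nat) (d : 'I_k -> nat) (M : plurimatroid n d).
Variable I0 : forall i, dsubset n (d i).
Hypothesis basis_I0 : forall i, val (I0 i) \in bases (M i).

Definition entry_index : finType := {i : 'I_k & 'I_(d i) * 'I_n}%type.
(** The second summand is for the inverses of the minors. Non-bases keep a coordinate too, which the
    model fixes at 0; this keeps the index type independent of [M]. *)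
Definition coord_index : finType := (entry_index + plucker_index n d)%type.
Notation N := #|coord_index|.

Definition entry_rank i (a : 'I_(d i)) (b : 'I_n) : 'I_N :=
  enum_rank (inl (Tagged (fun i => 'I_(d i) * 'I_n)%type (a, b)) : coord_index).

Definition minor_rank i (I : dsubset n (d i)) : 'I_N :=
  enum_rank (inr (Tagged (fun i => dsubset n (d i)) I) : coord_index).

Definition coord_mx (y : 'rV[K]_N) i : 'M[K]_(d i, n) :=
  \matrix_(a, b) y 0 (entry_rank a b).

Definition generic_mx i : 'M[{mpoly K[N]}]_(d i, n) :=
  \matrix_(a, b) 'X_(entry_rank a b).

Definition generic_minor i (I : dsubset n (d i)) : {mpoly K[N]} :=
  \det (colsub (dsubset_enum I) (generic_mx i)).

Definition affine_model : set 'rV[K]_N :=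
  [set y | [/\ forall i, colsub (dsubset_enum (I0 i)) (coord_mx y i) = 1%:M,
      forall i j : 'I_k, (i <= j)%N -> coord_mx y i =
        colsub (dsubset_enum (I0 j)) (coord_mx y i) *m coord_mx y j &
      forall i (I : dsubset n (d i)), if val I \in bases (M i)
        then y 0 (minor_rank I) * minor (coord_mx y i) I = 1
        else minor (coord_mx y i) I = 0 /\ y 0 (minor_rank I) = 0]].

(** At a non-basis the minor is 0 on the cell, and the convention [0^-1 = 0] yields the value that
    [affine_model] prescribes. *)
Definition to_model (W : 'I_k -> {vspace 'rV[K]_n}) : 'rV[K]_N :=
  \row_j match enum_val j with
    | inl x => chart_mx (I0 (tag x)) (W (tag x)) (tagged x).1 (tagged x).2
    | inr x => (minor (chart_mx (I0 (tag x)) (W (tag x))) (tagged x))^-1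
    end.

Definition of_model (y : 'rV[K]_N) : 'I_k -> {vspace 'rV[K]_n} :=
  fun i => rowspan (coord_mx y i).

Lemma map_generic_mx (y : 'rV[K]_N) i :
  map_mx (meval (fun j => y 0 j)) (generic_mx i) = coord_mx y i.
Proof. by apply/matrixP => a b; rewrite !mxE mevalXU. Qed.

Lemma meval_generic_minor (y : 'rV[K]_N) i (I : dsubset n (d i)) :
  (generic_minor I).@[fun j => y 0 j] = minor (coord_mx y i) I.
Proof. by rewrite -map_generic_mx /minor -map_mxsub det_map_mx. Qed.

(** All polynomials vanishing on the model are taken as equations. A common zero lies in the model
    because each defining condition equates values of polynomials. *)
Lemma affine_model_closed :
  zariski_closed (@affine_forms K N) setT affine_model.
Proof.
exists [set p | affine_forms tt p /\ forall y, affine_model y -> p y = 0].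
  by move=> p [Ap _]; exists tt.
apply/seteqP; split=> [y Yy|y [_ Sy]]; first by split=> // p [_]; exact.
have eqY (P Q : {mpoly K[N]}) :
    (forall z, affine_model z -> P.@[fun j => z 0 j] = Q.@[fun j => z 0 j]) ->
  P.@[fun j => y 0 j] = Q.@[fun j => y 0 j].
  move=> PQ; apply/eqP; rewrite -subr_eq0 -mevalB; apply/eqP.
  apply: (Sy (fun z => (P - Q).@[fun j => z 0 j])); split; first by exists (P - Q).
  by move=> z Yz; rewrite mevalB PQ // subrr.
have eqmxY m p (P Q : 'M[{mpoly K[N]}]_(m, p)) :
    (forall z, affine_model z -> map_mx (meval (fun j => z 0 j)) P =
                                 map_mx (meval (fun j => z 0 j)) Q) ->
  map_mx (meval (fun j => y 0 j)) P = map_mx (meval (fun j => y 0 j)) Q.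
  move=> PQ; apply/matrixP => a b; rewrite !mxE; apply: eqY => z /PQ /matrixP.
  by move=> /(_ a b); rewrite !mxE.
split=> [i|i j ij|i I].
- rewrite -map_generic_mx -map_mxsub -(map_mx1 (meval (fun j => y 0 j))).
  apply: eqmxY => z [+ _ _] => /(_ i).
  by rewrite map_mxsub map_mx1 map_generic_mx.
- rewrite -!map_generic_mx -map_mxsub -map_mxM.
  apply: eqmxY => z [_ + _] => /(_ i j ij).
  by rewrite map_mxM map_mxsub !map_generic_mx.
- rewrite -meval_generic_minor -[y 0 _](mevalXU (fun j => y 0 j)); case: ifP => BI.
    rewrite -mevalM -(mevalC (fun j => y 0 j) 1); apply: eqY => z [_ _] /(_ i I).
    by rewrite BI mevalM meval_generic_minor mevalXU mevalC.
  rewrite -(mevalC (fun j => y 0 j) 0); split; apply: eqY => z [_ _] /(_ i I).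
    by rewrite BI meval_generic_minor mevalC => -[].
  by rewrite BI mevalXU mevalC => -[].
Qed.

Lemma flag_cell_plucker W i (I : dsubset n (d i)) :
  flag_cell K M W -> (plucker (W i) I != 0) = (val I \in bases (M i)).
Proof.
move=> [/(_ i)[_ /(_ I) pI] _]; apply/idP/idP => [/eqP|]; first by move/pI.
by move=> /pI /eqP.
Qed.

Lemma coord_mx_to_model W i :
  coord_mx (to_model W) i = chart_mx (I0 i) (W i).
Proof. by apply/matrixP => a b; rewrite [LHS]mxE mxE enum_rankK. Qed.

Lemma to_model_minor W i (I : dsubset n (d i)) :
  to_model W 0 (minor_rank I) = (minor (chart_mx (I0 i) (W i)) I)^-1.
Proof. by rewrite mxE enum_rankK. Qed.

Lemma to_model_in W : flag_cell K M W -> affine_model (to_model W).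
Proof.
move=> XW; have p0 i : plucker (W i) (I0 i) != 0 by rewrite flag_cell_plucker.
split=> [i|i j ij|i I]; rewrite ?coord_mx_to_model ?to_model_minor.
- exact: chart_mx_col.
- have [_ [dW sW]] := XW.
  have /rowspan_subP[C CE] :
      (rowspan (chart_mx (I0 i) (W i)) <= rowspan (chart_mx (I0 j) (W j)))%VS.
    by rewrite !(rowspan_chart_mx (dW _) (p0 _)); exact: sW.
  (* On the columns in [I0 j] the chart matrix of [W j] is the identity, which identifies [C] as a
     column block of the chart matrix of [W i]. *)
  by rewrite [in LHS]CE CE -mulmx_colsub chart_mx_col // mulmx1.
- have : (plucker (W i) I != 0) = (val I \in bases (M i)).
    exact: flag_cell_plucker.
  rewrite (plucker_chart_mx _ (p0 i)) mulf_eq0 negb_or p0 /=.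
  case: ifP => _; first by move=> m0; rewrite mulVf.
  by move=> /negbFE/eqP ->; rewrite invr0.
Qed.

(** [vbasis] may pick a basis other than the rows of [coord_mx y i]; the change of basis scales all
    minors by the coordinate at [I0 i], where the minor is 1. *)
Lemma plucker_of_model y i (I : dsubset n (d i)) : affine_model y ->
  plucker (of_model y i) I = plucker (of_model y i) (I0 i) * minor (coord_mx y i) I.
Proof.
move=> [Y1 _ _]; have [_ p0 cE] := chart_mx_rowspan (Y1 i).
by rewrite (plucker_chart_mx _ p0) cE.
Qed.

Lemma plucker_of_model_neq0 y i :
  affine_model y -> plucker (of_model y i) (I0 i) != 0.
Proof. by move=> [/(_ i)/chart_mx_rowspan[]]. Qed.

Lemma of_model_in y : affine_model y -> flag_cell K M (of_model y).
Proof.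
move=> Yy; have [Y1 Y2 Y3] := Yy.
have dim_y i : \dim (of_model y i) = d i by have [] := chart_mx_rowspan (Y1 i).
split; last first.
  by split=> // i j ij; apply/rowspan_subP; eexists; exact: Y2.
move=> i; split; first exact: dim_y.
move=> I; rewrite plucker_of_model //; have := Y3 i I.
have p0 := plucker_of_model_neq0 i Yy; case: ifP => BI yE; split=> //.
  move=> _; apply/eqP; rewrite mulf_neq0 //; apply/eqP => m0.
  by move/eqP: yE; rewrite m0 mulr0 eq_sym oner_eq0.
by case: yE => -> _; rewrite mulr0.
Qed.

Lemma to_modelK W : flag_cell K M W -> of_model (to_model W) = W.
Proof.
move=> XW; apply/funext => i; rewrite /of_model coord_mx_to_model.
have [_ [dW _]] := XW; apply: rowspan_chart_mx; first exact: dW.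
by rewrite flag_cell_plucker.
Qed.

Lemma of_modelK y : affine_model y -> to_model (of_model y) = y.
Proof.
move=> [Y1 _ Y3]; apply/rowP => j; rewrite mxE -[in RHS](enum_valK j).
have cE i : chart_mx (I0 i) (of_model y i) = coord_mx y i.
  by have [] := chart_mx_rowspan (Y1 i).
case: (enum_val j) => [[i [a b]]|[i I]] /=; rewrite cE; first by rewrite mxE.
(* At a basis the equation determines the inverse of the minor; at a non-basis both sides are 0,
   again by [0^-1 = 0]. *)
have := Y3 i I; case: ifP => _ => [yE|[-> ->]]; last by rewrite invr0.
have m0 : minor (coord_mx y i) I != 0.
  by apply/eqP => m0; move/eqP: yE; rewrite m0 mulr0 eq_sym oner_eq0.
by apply: (mulIf m0); rewrite mulVf.
Qed.

(** Every coordinate is a global fraction: matrix entries are constants times [p_J / p_(I0 i)],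
    inverse minors at bases are [p_(I0 i) / p_I], and the remaining coordinates are 0. *)
Lemma to_model_morphism : morphism_on (plucker_forms K n d)
  (@affine_forms K N) (flag_cell K M) affine_model to_model.
Proof.
apply: pulls_back_forms_morphism to_model_in _.
have frac i (I J : dsubset n (d i)) : val I \in bases (M i) ->
    global_fraction (plucker_forms K n d) (flag_cell K M)
      (fun W => plucker (W i) J / plucker (W i) I).
  move=> BI; exists (fun j => (i == j) : nat), (fun W => plucker (W i) J).
  exists (fun W => plucker (W i) I); split; try exact: plucker_forms_coord.
  by move=> W XW; rewrite flag_cell_plucker.
have p0 W i : flag_cell K M W -> plucker (W i) (I0 i) != 0.
  by move=> XW; rewrite flag_cell_plucker.
apply: (pulls_back_affine_forms (@plucker_formsC K n k d)
  (@plucker_formsD K n k d) (@plucker_formsM K n k d)) => j.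
rewrite -[j]enum_valK; case: (enum_val j) => [[i [a b]]|[i I]].
  have [c [J cE]] := chart_mx_entry K (I0 i) a b.
  apply: global_fraction_eq (global_fractionM (@plucker_formsM K n k d)
    (global_fractionC (@plucker_formsC K n k d) _ c) (frac i _ J (basis_I0 i))).
  by move=> W XW; rewrite mxE enum_rankK /= cE ?p0 // mulrA.
have [BI|BI] := boolP (val I \in bases (M i)).
  apply: global_fraction_eq (frac i _ (I0 i) BI) => W XW.
  rewrite to_model_minor (plucker_chart_mx I (p0 W i XW)) invfM mulrA.
  by rewrite divff ?mul1r ?p0.
apply: global_fraction_eq (global_fractionC (@plucker_formsC K n k d) _ 0) => W XW.
have := flag_cell_plucker I XW; rewrite (negPf BI) => /negbFE.
rewrite (plucker_chart_mx _ (p0 W i XW)) mulf_eq0 (negPf (p0 W i XW)) /=.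
by rewrite to_model_minor => /eqP ->; rewrite invr0.
Qed.

(** Substituting the generic minors for the Plücker variables turns a form into a polynomial, up to
    a product of powers of the coordinates at [I0]. This factor depends only on the multidegree,
    hence is common to numerator and denominator. *)
Lemma of_model_morphism : morphism_on (@affine_forms K N)
  (plucker_forms K n d) affine_model (flag_cell K M) of_model.
Proof.
apply: pulls_back_forms_morphism of_model_in _.
pose minors := [tuple generic_minor (tagged (enum_val j : plucker_index n d))
               | j < #|plucker_index n d|].
have pull e (P : {mpoly K[#|plucker_index n d|]}) y :
    multihomogeneous e P -> affine_model y ->
  P.@[fun j => let x : plucker_index n d := enum_val j in
               plucker (of_model y (tag x)) (tagged x)] =
  (\prod_i plucker (of_model y i) (I0 i) ^+ e i) *
    (P \mPo minors).@[fun j => y 0 j].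
  move=> hP Yy; rewrite comp_mpoly_meval.
  rewrite [X in _ * X](@meval_eq _ _ _
    (fun j => minor (coord_mx y (tag (enum_val j))) (tagged (enum_val j))));
    last first.
    by move=> j; rewrite !tnth_map tnth_ord_tuple meval_generic_minor.
  rewrite -(meval_multihomogeneous (fun i => plucker (of_model y i) (I0 i))
    (fun x => minor (coord_mx y (tag x)) (tagged x)) hP).
  by apply: meval_eq => j; rewrite -plucker_of_model.
move=> e _ _ [P hP ->] [Q hQ ->]; exists tt.
exists (fun y => (P \mPo minors).@[fun j => y 0 j]).
exists (fun y => (Q \mPo minors).@[fun j => y 0 j]).
exists (fun y => \prod_i plucker (of_model y i) (I0 i) ^+ e i); split.
- by eexists.
- by eexists.
- move=> y Yy; split; [|exact: pull|exact: pull].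
  by apply/prodf_neq0 => i _; rewrite expf_neq0 // plucker_of_model_neq0.
Qed.

Lemma flag_cell_affine : is_affine (plucker_forms K n d) (flag_cell K M).
Proof.
exists N, affine_model; split; first exact: affine_model_closed.
exists to_model, of_model; split.
- exact: to_model_morphism.
- exact: of_model_morphism.
- exact: to_modelK.
- exact: of_modelK.
Qed.

End AffineModel.

(** * Local closedness in the flag variety *)

Lemma flag_cell_locally_closed (K : fieldType) (n k : nat) (d : 'I_k -> nat)
    (M : plurimatroid n d) :
  locally_closed (plucker_forms K n d) (flag_variety K d) (flag_cell K M).
Proof.
pose on_bases (x : plucker_index n d) := val (tagged x) \in bases (M (tag x)).
(* Multiplying the basis coordinates makes the complement of the open part the zero locus of one
   form. *)
pose F (W : 'I_k -> {vspace 'rV[K]_n}) :=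
  \prod_(x | on_bases x) plucker (W (tag x)) (tagged x).
have coordE (x : plucker_index n d) : exists e, plucker_forms K n d e
    (fun W => plucker (W (tag x)) (tagged x)).
  by eexists; exact: plucker_forms_coord.
have [e FE] : exists e, plucker_forms K n d e F.
  have [e Fe] := plucker_forms_prod (enum on_bases) coordE.
  exists e; rewrite (_ : F = (fun W =>
    \prod_(x <- enum on_bases) plucker (W (tag x)) (tagged x))) //.
  by apply/funext => W; rewrite big_enum.
exists [set W | flag_variety K d W /\ F W != 0].
exists (flag_variety K d `&` zero_locus [set p | exists2 x, ~~ on_bases x &
  p = fun W => plucker (W (tag x)) (tagged x)]); split.
- split; first by move=> W [].
  exists [set F]; first by move=> _ ->; exists e.
  apply/seteqP; split=> W [fW].
    move=> nW; split=> // _ ->; apply/eqP/negPn/negP => FW.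
    exact: nW.
  by move=> /(_ F erefl) FW; split=> // -[_]; rewrite FW eqxx.
- eexists; last reflexivity.
  by move=> _ [x _ ->].
- apply/seteqP; split=> W.
    move=> XW; have [_ fW] := XW; split; split=> //.
      apply/prodf_neq0 => x; rewrite /on_bases => Bx.
      by rewrite (flag_cell_plucker _ XW).
    move=> _ [x Bx ->]; apply/eqP; move: Bx; rewrite /on_bases.
    by rewrite -(flag_cell_plucker _ XW) negbK.
  move=> [[fW /prodf_neq0 FW] [_ ZW]]; split=> // i; split; first by have [] := fW.
  move=> I; pose x : plucker_index n d := Tagged (fun i => dsubset n (d i)) I.
  split=> [pI|BI]; last by apply/eqP; exact: (FW x).
  apply/negPn/negP => BI; apply: pI.
  by apply: (ZW (fun W => plucker (W (tag x)) (tagged x))); exists x.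
Qed.

Theorem lemma3p2 (R : realType) (n k : nat) (d : 'I_k -> nat)
    (k_gt0 : (0 < k)%N)
    (d_gt0 : forall i : 'I_k, (0 < d i)%N)
    (d_incr : forall i j : 'I_k, (i < j)%N -> (d i < d j)%N)
    (d_ltn : forall i : 'I_k, (d i < n)%N)
    (M : plurimatroid n d) :
  is_affine (plucker_forms R[i]%C n d) (flag_cell R[i]%C M) /\
  locally_closed (plucker_forms R[i]%C n d)
    (flag_variety R[i]%C d) (flag_cell R[i]%C M).
Proof.
split; last exact: flag_cell_locally_closed.
have nonempty i : exists I, I \in bases (M i) by apply/set0Pn/bases_neq0.
(* An arbitrary basis of each [M i] fixes the chart used for the [i]-th subspace. *)
pose I0 i : dsubset n (d i) :=
  exist (fun I : {set 'I_n} => #|I| == d i) (xchoose (nonempty i))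
    (introT eqP (bases_card (xchooseP (nonempty i)))).
by apply: (@flag_cell_affine _ _ _ _ _ I0) => i; exact: xchooseP.
Qed.
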